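(* Let $G$ be an $n$-vertex, $K_{r+1}$-free graph where $r \ge 3$. For every $k \ge 0$, if $G$ is not $k$-path Hamiltonian and $$n \ge \begin{cases} 6k+26 & \text{if } r=3\\ 5k+11 & \text{if } 4 \le r \le 7\\ k+5+ 4(k+4)/(r-4) & \text{if } r \ge 8,\end{cases}$$ then $e(G) \leq e(T_r(n-1)) + (k+1)$. The set $\mathcal{J}^k_{n,r}$ is nonempty, and equality holds if $G \in \mathcal{J}^k_{n,r}$.
   Context: Graphs are finite and simple; $n,r,k$ are integers; $e(G)$ is the number of edges of $G$. $T_r(n)$ is the $n$-vertex, $r$-partite Turán graph: the complete $r$-partite graph on $n$ vertices with part sizes differing by at most 1 (if $n<r$ some parts are empty and it is $K_n$). An $n$-vertex graph is $k$-path Hamiltonian ($0 \le k \le n-2$) if every path of length (number of edges) at most $k$ is contained in a Hamiltonian cycle. A graph is traceable if it contains a Hamiltonian path. $\mathcal{J}^k_{n,r}$ is the set of $n$-vertex, $K_{r+1}$-free graphs consisting of $T_r(n-1)$ plus one additional vertex of degree $k+1$ whose neighborhood (i.e., the subgraph induced by its set of neighbors) is traceable. *)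

(* Defs.v *)
From mathcomp Require Import all_boot all_order all_algebra.

Set Implicit Arguments.
Unset Strict Implicit.
Unset Printing Implicit Defensive.

Import Order.TTheory GRing.Theory Num.Theory.

Record sgraph (T : finType) := SGraph {
  adj :> rel T;
  adj_sym : symmetric adj;
  adj_irr : irreflexive adj }.

Definition edges (T : finType) (G : sgraph T) : {set {set T}} :=
  [set [set xy.1; xy.2] | xy : T * T & G xy.1 xy.2].

Definition num_edges (T : finType) (G : sgraph T) : nat := #|edges G|.

Definition nbhd (T : finType) (G : sgraph T) (v : T) : {set T} :=
  [set w | G v w].

Definition degree (T : finType) (G : sgraph T) (v : T) : nat := #|nbhd G v|.

Definition is_clique (T : finType) (G : sgraph T) (A : {set T}) : Prop :=
  {in A &, forall x y, x != y -> G x y}.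

Definition clique_free (T : finType) (m : nat) (G : sgraph T) : Prop :=
  forall A : {set T}, #|A| = m -> ~ is_clique G A.

Section Induced.
Variables (T : finType) (G : sgraph T) (A : {set T}).

Definition induced_adj : rel {x : T | x \in A} := fun x y => G (val x) (val y).

Fact induced_sym : symmetric induced_adj.
Proof. by move=> x y; apply: adj_sym. Qed.

Fact induced_irr : irreflexive induced_adj.
Proof. by move=> x; apply: adj_irr. Qed.

Definition induced : sgraph {x : T | x \in A} := SGraph induced_sym induced_irr.

End Induced.

Definition isomorphic (S T : finType) (G : sgraph S) (H : sgraph T) : Prop :=
  exists2 f : S -> T, bijective f & forall x y, H (f x) (f y) = G x y.

(* The parts are the residue classes modulo r; their sizes differ by at most 1
   by [turan_balanced], and some of them are empty when m < r. *)
Section Turan.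
Variables r m : nat.

Definition turan_adj : rel 'I_m := fun i j => i %% r != j %% r.

Fact turan_sym : symmetric turan_adj.
Proof. by move=> i j; rewrite /turan_adj eq_sym. Qed.

Fact turan_irr : irreflexive turan_adj.
Proof. by move=> i; rewrite /turan_adj eqxx. Qed.

Definition turan : sgraph 'I_m := SGraph turan_sym turan_irr.

Definition turan_part (a : 'I_r) : {set 'I_m} := [set i : 'I_m | i %% r == a].

Fact turan_balanced (a b : 'I_r) : #|turan_part a| <= #|turan_part b|.+1.
Proof.
have r_gt0 : 0 < r := leq_ltn_trans (leq0n a) (ltn_ord a).
pose h (i : nat) := i %/ r * r - r + b.
case: (posnP m) => [m0|m_gt0].
  have le_m : #|turan_part a| <= m by rewrite -[X in _ <= X]card_ord max_card.
  by apply: leq_trans le_m _; rewrite [X in X <= _]m0.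
pose o : 'I_m := Ordinal m_gt0.
pose A := [set i in turan_part a | r <= i].
have hA i : i \in A -> [/\ i %% r = a, r <= i & h i < m].
  rewrite !inE => /andP[/eqP ia ri]; split=> //.
  have q_gt0 : 0 < i %/ r by rewrite divn_gt0.
  apply: leq_ltn_trans (ltn_ord i); apply: leq_trans (leq_divM i r).
  have rq : r <= i %/ r * r by rewrite leq_pmull.
  by rewrite -[X in _ <= X](subnK rq) leq_add2l ltnW.
have AB : #|A| <= #|turan_part b|.
  rewrite -(@card_in_imset _ _ (fun i : 'I_m => insubd o (h i)) (mem A)).
    apply/subset_leq_card/subsetP=> _ /imsetP[i iA ->].
    have [_ ri hi] := hA i iA; rewrite inE val_insubd hi /h.
    by rewrite -[X in _ - X]mul1n -mulnBl modnMDl modn_small ?eqxx.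
  move=> i j iA jA /(congr1 val); have [ia ri hi] := hA i iA.
  have [ja rj hj] := hA j jA; rewrite !val_insubd hi hj => /addIn e.
  apply/val_inj; rewrite /= (divn_eq i r) (divn_eq j r) ia ja.
  have le_r k : r <= k -> r <= k %/ r * r by move=> rk; rewrite leq_pmull ?divn_gt0.
  by rewrite -(subnK (le_r _ ri)) e subnK ?le_r.
rewrite -(cardsID A) -addn1 leq_add //.
  by apply: leq_trans AB; apply/subset_leq_card/subsetIr.
rewrite -[X in _ <= X](cards1 (insubd o a)).
apply/subset_leq_card/subsetP=> i; rewrite !inE => /andP[+ /eqP ia].
rewrite ia eqxx /= -ltnNge => ir; rewrite modn_small // in ia.
by apply/eqP/val_inj; rewrite val_insubd -ia ltn_ord.
Qed.

End Turan.

(* A path is given by its first vertex and the sequence of the later ones, so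
   that its length (number of edges) is [size p]. *)
Definition is_path (T : finType) (G : sgraph T) (x : T) (p : seq T) : Prop :=
  path G x p /\ uniq (x :: p).

Definition traceable (T : finType) (G : sgraph T) : Prop :=
  exists x p, is_path G x p /\ (forall y, y \in x :: p).

(* The size condition excludes single vertices and single edges, which
   [cycle] alone would allow. *)
Definition hamiltonian_cycle (T : finType) (G : sgraph T) (c : seq T) : Prop :=
  [/\ cycle G c, uniq c, 2 < size c & forall y, y \in c].

Definition cycle_adj (T : eqType) (c : seq T) : rel T :=
  fun y z => (next c y == z) || (next c z == y).

Definition path_hamiltonian (T : finType) (k : nat) (G : sgraph T) : Prop :=
  forall x p, is_path G x p -> size p <= k ->
  exists2 c, hamiltonian_cycle G c & path (cycle_adj c) x p.

(* The family J^k_{n,r}, for graphs on a vertex set with n elements. *)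
Definition J_family (k n r : nat) (T : finType) (G : sgraph T) : Prop :=
  [/\ #|T| = n,
      clique_free r.+1 G
    & exists v : T, [/\ isomorphic (turan r n.-1) (induced G [set~ v]),
                        degree G v = k.+1
                      & traceable (induced G (nbhd G v))]].

Local Open Scope ring_scope.

Definition order_bound (r k : nat) : rat :=
  if r == 3%N then 6 * k%:R + 26
  else if (r <= 7)%N then 5 * k%:R + 11
  else k%:R + 5 + 4 * (k%:R + 4) / (r%:R - 4).

(* Main.v *)
(* Fix a path P with at most k edges that lies on no Hamiltonian cycle. Joining nonadjacent vertices
   whose degrees sum to at least n + k preserves this, so the Bondy-Chvatal closure is not complete
   and, as in Chvatal's theorem, there is h < (n + k) / 2 such that at least max(1, h - k) vertices
   have degree at most h. If h <= k + 1, deleting one of them and applying Turan's theorem to the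
   rest gives the bound. Otherwise delete s = h - k of them: for r >= 4 the order condition yields
   e(T_r(n - s)) + s (k + s) <= e(T_r(n - 1)) + k + 1. For r = 3 this fails when s is close to
   (n - k) / 2, and the vertices of low degree are weighed against the largest number of neighbours
   that a vertex has outside of them (num_edges_K4_free).
   Turan's theorem is proved by deleting a vertex of minimum degree, which is at most m - m / r in a
   K_{r+1}-free graph on m + 1 vertices. *)
Require Import Defs.
From mathcomp Require Import all_boot all_order all_algebra.
From mathcomp Require Import zify.

Set Implicit Arguments.
Unset Strict Implicit.
Unset Printing Implicit Defensive.

(** * Edge counts *)

Section EdgeCounting.
Variables (T : finType) (G : sgraph T).
Implicit Types (A B X : {set T}) (x y v : T).

Definition degree_in X x : nat := \sum_(y in X) G x y.

(** Ordered pairs count each edge inside [X] twice; deleting vertices then amounts to splitting a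
    double sum over subsets of [T], without induced subgraphs. *)
Definition arcs X : nat := \sum_(x in X) degree_in X x.

Lemma degree_in_card X x : degree_in X x = #|X :&: nbhd G x|.
Proof.
rewrite /degree_in -sum1_card [RHS](eq_bigl (fun y => (y \in X) && G x y)).
  by rewrite big_mkcondr; apply: eq_bigr => y _; case: (G x y).
by move=> y; rewrite !inE.
Qed.

Lemma degree_in_setT x : degree_in setT x = degree G x.
Proof. by rewrite degree_in_card setTI. Qed.

Lemma degree_inS A B x : A \subset B -> degree_in A x <= degree_in B x.
Proof. by move=> sAB; rewrite !degree_in_card subset_leq_card ?setSI. Qed.

Lemma degree_in_sub A X x : A \subset X ->
  degree_in X x = degree_in A x + degree_in (X :\: A) x.
Proof. by move=> sAX; rewrite /degree_in (big_setID A) /= (setIidPr sAX). Qed.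

(** An arc not inside [A] either starts at some [x] outside [A], counted by [degree_in X x], or runs
    from [A] to such an [x], counted by symmetry in [degree_in A x]. *)
Lemma arcs_split A X : A \subset X ->
  arcs X = arcs A + \sum_(x in X :\: A) (degree_in A x + degree_in X x).
Proof.
move=> sAX; rewrite {1}/arcs (big_setID A) /= (setIidPr sAX) big_split /= addnA.
congr (_ + _).
under eq_bigr do rewrite (degree_in_sub _ sAX).
rewrite big_split /=; congr (_ + _); rewrite exchange_big /=.
by apply: eq_bigr => x _; apply: eq_bigr => y _; rewrite adj_sym.
Qed.

Lemma arcs_delete_le A X : A \subset X ->
  arcs X <= arcs A + (\sum_(x in X :\: A) degree_in X x).*2.
Proof.
move=> sAX; rewrite (arcs_split sAX) leq_add2l -addnn big_split leq_add2r.
by apply: leq_sum => x _; apply: degree_inS.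
Qed.

Lemma arcs_double_edges : arcs setT = (num_edges G).*2.
Proof.
pose D := [set xy : T * T | G xy.1 xy.2].
have -> : arcs setT = #|D|.
  rewrite /arcs /degree_in pair_big /= -sum1_card big_mkcond [RHS]big_mkcond /=.
  by apply: eq_bigr => -[x y] _; rewrite !inE /=; case: (G x y).
(* Arcs are grouped by their unordered pair; the fibre over an edge consists of [(x, y)] and
   [(y, x)]. *)
rewrite -sum1_card (partition_big_imset (fun xy : T * T => [set xy.1; xy.2])) /=.
have -> : [set [set xy.1; xy.2] | xy in D] = edges G.
  by apply/setP=> e; apply/imsetP/imsetP=> -[xy xyD ->]; exists xy; move: xyD; rewrite !inE.
rewrite -muln2 -sum_nat_const; apply: eq_bigr => e /imsetP[[x y]].
rewrite inE /= => Gxy ->; have neq_xy : x != y.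
  by apply: contraTneq Gxy => ->; rewrite adj_irr.
have neq_arc : (x, y) != (y, x) by rewrite xpair_eqE negb_and neq_xy.
transitivity #|[set (x, y); (y, x)]|; last by rewrite cards2 neq_arc.
rewrite sum1_card; apply: eq_card => -[a b]; rewrite !inE /= !xpair_eqE.
rewrite -[LHS]topredE /= inE /=.
apply/andP/orP=> [[Gab /eqP eab]|]; last first.
  by case=> /andP[/eqP-> /eqP->]; rewrite ?[G y x]adj_sym Gxy ?eqxx // setUC.
have /andP[] : (a \in [set x; y]) && (b \in [set x; y]) by rewrite -eab set21 set22.
rewrite !inE => /orP[]/eqP ea /orP[]/eqP eb; subst a b; rewrite ?eqxx; auto.
  by rewrite adj_irr in Gab.
by rewrite adj_irr in Gab.
Qed.

End EdgeCounting.

(** * Turan's theorem *)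

(** The edges of the Turan graph, built up one vertex at a time: vertex [i] has [i - i %/ r] earlier
    vertices outside its residue class. *)
Definition turan_size r m : nat := \sum_(i < m) (i - i %/ r).

Lemma turan_sizeS r m : turan_size r m.+1 = turan_size r m + (m - m %/ r).
Proof. by rewrite /turan_size big_ord_recr. Qed.

(** Exact form of the estimate [(1 - 1/r) m^2 / 2]; for fixed small [r] the remainder term is
    bounded by a constant. In the induction the residue of [m] grows by one or wraps around to 0. *)
Lemma turan_sizeE r m : 0 < r ->
  2 * r * turan_size r m + (m %% r) * (r - m %% r) = r.-1 * m ^ 2.
Proof.
case: r => // r _; elim: m => [|m IHm]; first by rewrite /turan_size big_ord0 mod0n !muln0.
rewrite turan_sizeS modnS.
have := ltn_pmod m (ltn0Sn r); have := divn_eq m r.+1.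
move: IHm; set t := turan_size _ _; set q := m %/ _; set j := m %% _ => IHm defm ltj.
have -> : (r.+1 %| m.+1) = (j == r).
  rewrite /dvdn -addn1 -modnDml -/j addn1;
  case: (ltngtP j r) => [ltjr|ltrj|->]; last by rewrite modnn eqxx.
    by rewrite modn_small.
  by lia.
have -> : m - q = q * r + j by rewrite defm mulnS; lia.
case: eqP => [ej|/eqP neqjr]; first by rewrite ej subSnn in IHm defm *; rewrite defm in IHm *; lia.
have [d defr] : exists d, r = j + d.+1 by exists (r - j.+1); lia.
have -> : r.+1 - j.+1 = d.+1 by lia.
have ed : r.+1 - j = d.+2 by lia.
by rewrite ed defm defr /= in IHm *; lia.
Qed.

(** Each new vertex [i] adds at least [(r - 1) i / r] edges. The loss is proportional to [t],
    whereas the remainders in [turan_sizeE] need not vanish with [t]. *)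
Lemma turan_size_increment r m t : 0 < r ->
  r.-1 * (t * (2 * m + t)) + 2 * r * turan_size r m
    <= 2 * r * turan_size r (m + t) + r.-1 * t.
Proof.
move=> r_gt0; elim: t => [|t IHt]; first by rewrite mul0n !muln0 !addn0.
rewrite [m + t.+1]addnS turan_sizeS; have := leq_divM (m + t) r.
move: (_ %/ _) (turan_size _ (m + t)) (turan_size _ _) IHt => q a b.
case: r r_gt0 => // r _ /= IHt le_q.
have : r * (m + t) <= r.+1 * (m + t - q) by nia.
by lia.
Qed.

Lemma sum_eq_mod r m c : c < r -> \sum_(j < m) (j %% r == c) = (m + (r.-1 - c)) %/ r.
Proof.
move=> ltcr; have r_gt0 : 0 < r by apply: leq_ltn_trans ltcr.
elim: m => [|m IHm]; first by rewrite big_ord0 divn_small; lia.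
rewrite big_ord_recr /= IHm addSn divnS // addnC; congr (_ + _); congr nat_of_bool.
have -> : (m + (r.-1 - c)).+1 = m + (r - c) by lia.
rewrite /dvdn -modnDml; have := ltn_pmod m r_gt0; move: (m %% r) => a ltar.
case: (ltngtP a c) => [ltac|ltca|->]; last by rewrite subnKC ?modnn // ltnW.
  by rewrite modn_small; lia.
have -> : a + (r - c) = (a - c) + r by lia.
by rewrite modnDr modn_small; lia.
Qed.

Lemma sum_neq_mod r m : 0 < r -> \sum_(j < m) (j %% r != m %% r) = m - m %/ r.
Proof.
move=> r_gt0; have <- : \sum_(j < m) (j %% r == m %% r) = m %/ r.
  rewrite sum_eq_mod ?ltn_pmod // {1}(divn_eq m r) -addnA divnMDl //.
  move: (m %% r) (ltn_pmod m r_gt0) => j ltjr.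
  by rewrite [_ %/ r in X in _ + X]divn_small ?addn0 //; lia.
apply/esym/eqP; rewrite -(eqn_add2r (\sum_(j < m) (j %% r == m %% r))) subnK.
  rewrite -big_split /= (eq_bigr (fun=> 1)) ?sum1_card ?card_ord // => j _.
  by case: eqP.
rewrite -[X in _ <= X]card_ord -sum1_card; apply: leq_sum => j _; exact: leq_b1.
Qed.

Lemma num_edges_turan r m : 0 < r -> num_edges (turan r m) = turan_size r m.
Proof.
move=> r_gt0; apply/double_inj; rewrite -arcs_double_edges.
transitivity (\sum_(i < m) \sum_(j < m) (i %% r != j %% r) : nat).
  by apply: eq_big => [i|i _]; rewrite ?inE //; apply: eq_bigl => j; rewrite inE.
elim: m => [|m IHm]; first by rewrite /turan_size !big_ord0.
rewrite turan_sizeS big_ord_recr /= big_ord_recr /= eqxx addn0.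
under eq_bigr do rewrite big_ord_recr /=.
rewrite big_split /= IHm sum_neq_mod //; under [X in _ + X]eq_bigr do rewrite eq_sym.
by rewrite sum_neq_mod // doubleD -addnA addnn.
Qed.

(** * The upper bound in Turan's theorem *)

Section TuranTheorem.
Variables (T : finType) (G : sgraph T).
Implicit Types (A B X : {set T}) (x y v : T).

Definition clique_free_in m B :=
  forall A, A \subset B -> #|A| = m -> ~ is_clique G A.

Lemma is_cliqueU1 A x : is_clique G A -> {in A, forall a, G a x} -> is_clique G (x |: A).
Proof.
move=> clA Ax y z; rewrite !inE => /orP[/eqP->|Ay] /orP[/eqP->|Az]; rewrite ?eqxx //.
- by rewrite adj_sym Ax.
- by rewrite Ax.
by apply: clA.
Qed.

(** Every vertex of [B] misses at most [q] vertices of [B], itself included, so each vertex chosen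
    removes at most [q] candidates. *)
Lemma clique_greedy B q j :
    {in B, forall x, #|B| <= degree_in G B x + q} -> j.-1 * q < #|B| ->
  exists A, [/\ A \subset B, #|A| = j & is_clique G A].
Proof.
move=> degB ltq.
(* The induction also tracks the size of the common neighbourhood, from which the next vertex is
   taken. *)
suff [A [sAB cA clA _]] : exists A, [/\ A \subset B, #|A| = j, is_clique G A
    & #|B| <= #|[set x in B | [forall a in A, G a x]]| + j * q].
  by exists A.
elim: j ltq => [|j IHj] /= ltq.
  exists set0; split; rewrite ?sub0set ?cards0 //; first by move=> x y; rewrite inE.
  rewrite addn0 subset_leq_card //; apply/subsetP=> x Bx.
  by rewrite inE Bx; apply/forall_inP=> a; rewrite inE.
have [|A [sAB cA clA leB]] := IHj.
  by apply: leq_ltn_trans ltq; rewrite leq_mul2r leq_pred orbT.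
set C := [set x in B | _] in leB.
have [x Cx] : exists x, x \in C by apply/card_gt0P; lia.
move: (Cx); rewrite inE => /andP[Bx /forall_inP Ax].
exists (x |: A); split.
- by rewrite subUset sub1set Bx.
- by rewrite cardsU1 cA; case: (boolP (x \in A)) => // /Ax; rewrite adj_irr.
- by apply: is_cliqueU1.
set C' := [set y in B | _].
have -> : C' = C :&: nbhd G x.
  apply/setP=> y; rewrite !inE -andbA; congr (_ && _).
  apply/forall_inP/andP=> [all_y|[/forall_inP Ay Gxy] a].
    by split; [apply/forall_inP=> a Aa|]; apply: all_y; rewrite !inE ?eqxx ?Aa ?orbT.
  by rewrite !inE => /orP[/eqP->//|]; apply: Ay.
have := degB x Bx; rewrite degree_in_card.
have := cardsID (nbhd G x) C; have := cardsID (nbhd G x) B.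
have : #|C :\: nbhd G x| <= #|B :\: nbhd G x|.
  by rewrite subset_leq_card // setSD //; apply/subsetP=> y; rewrite inE => /andP[].
lia.
Qed.

(** Otherwise [clique_greedy] with [q = #|B|.-1 %/ r] yields a clique on [r.+1] vertices, as
    [r * q < #|B|]. *)
Lemma low_degree_vertex r B : 0 < r -> clique_free_in r.+1 B -> 0 < #|B| ->
  exists2 x, x \in B & degree_in G B x <= #|B|.-1 - #|B|.-1 %/ r.
Proof.
move=> r_gt0 freeB B_gt0.
case: (pickP [pred x in B | degree_in G B x <= #|B|.-1 - #|B|.-1 %/ r]) => [x /andP[]|nox].
  by exists x.
have [||A [sAB cA]] := @clique_greedy B (#|B|.-1 %/ r) r.+1; last by move/(freeB A sAB cA).
  move=> x Bx; have /negbT := nox x; rewrite inE Bx /=; lia.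
by have := leq_divM #|B|.-1 r; lia.
Qed.

Lemma turan_bound r B : 0 < r -> clique_free_in r.+1 B ->
  arcs G B <= (turan_size r #|B|).*2.
Proof.
move=> r_gt0; move: {2}#|B| (erefl #|B|) => m; elim: m B => [|m IHm] B cB freeB.
  by rewrite (cards0_eq cB) /arcs big_set0.
have [|x Bx] := low_degree_vertex r_gt0 freeB; first by rewrite cB.
rewrite cB /= turan_sizeS doubleD => degx.
have sDB : B :\ x \subset B by apply: subD1set.
have cD : #|B :\ x| = m by move: cB; rewrite (cardsD1 x) Bx => -[].
apply: leq_trans (arcs_delete_le G sDB) _; apply: leq_add.
  by rewrite -cD IHm // => A sA; apply: freeB; apply: subset_trans sA sDB.
have -> : B :\: (B :\ x) = [set x] by rewrite setDDr setDv set0U; apply/setIidPr; rewrite sub1set.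
by rewrite big_set1 leq_double.
Qed.

End TuranTheorem.

(** * Hamiltonian cycles through a given path *)

Section Cycles.
Variable T : eqType.
Implicit Types (c p q : seq T) (x y z : T).

Lemma cycle_adj_sym c : symmetric (cycle_adj c).
Proof. by move=> y z; rewrite /cycle_adj orbC. Qed.

Lemma cycle_adj_rot i c : uniq c -> cycle_adj (rot i c) =2 cycle_adj c.
Proof. by move=> Uc y z; rewrite /cycle_adj !next_rot. Qed.

Lemma cycle_cycle_adj c : uniq c -> cycle (cycle_adj c) c.
Proof.
move=> Uc; apply: sub_cycle (cycle_next Uc) => y z /= /eqP <-.
by rewrite /cycle_adj eqxx.
Qed.

Lemma cycle_cat (e : rel T) z q1 b q2 :
  cycle e (z :: q1 ++ b :: q2) =
  [&& path e z q1, e (last z q1) b, path e b q2 & e (last b q2) z].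
Proof. by rewrite /= rcons_cat cat_path /= rcons_path. Qed.

(** Running through the second arc backwards trades the links from [last z q1] to [b] and from
    [last b q2] to [z] for links from [last z q1] to [last b q2] and from [b] to [z]. *)
Lemma cycle_cat_rev (e : rel T) z q1 b q2 : symmetric e ->
  cycle e (z :: q1 ++ rev (b :: q2)) =
  [&& path e z q1, e (last z q1) (last b q2), path e b q2 & e z b].
Proof.
move=> sym_e.
have -> : rev (b :: q2) = last b q2 :: rev (belast b q2) by rewrite lastI rev_rcons.
rewrite cycle_cat rev_path.
have -> : last (last b q2) (rev (belast b q2)) = b.
  by case: q2 => //= c q2; rewrite rev_cons last_rcons.
have -> : path (fun y => e^~ y) b q2 = path e b q2 by apply: eq_path => ? ?; apply: sym_e.
by rewrite [e b z]sym_e.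
Qed.

Lemma next_next_neq c y : uniq c -> 2 < size c -> y \in c -> next c (next c y) != y.
Proof.
move=> Uc c_gt2 /rot_to[i s def_s]; rewrite -!(next_rot i Uc).
have: uniq (rot i c) by rewrite rot_uniq.
have: 2 < size (rot i c) by rewrite size_rot.
rewrite def_s; case: s {def_s} => [|a [|b s]] //= _.
rewrite eqxx !inE !negb_or => /andP[/and3P[nya nyb _] _].
by rewrite [a == y]eq_sym (negPf nya) eqxx eq_sym.
Qed.

End Cycles.

Section HamiltonianCycles.
Variable T : finType.
Implicit Types (G H : sgraph T) (c p q : seq T) (x y z u v : T).

Definition path_edges x p : seq {set T} := pairmap (fun y z => [set y; z]) x p.

Lemma path_path_edges x p : path [rel y z | [set y; z] \in path_edges x p] x p.
Proof.
rewrite /path_edges.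
suff: forall s : seq {set T}, {subset pairmap (fun y z => [set y; z]) x p <= s} ->
  path [rel y z | [set y; z] \in s] x p by apply.
elim: p x => //= y p IHp x s sub_s; rewrite sub_s ?mem_head //= IHp // => e pe.
by rewrite sub_s // inE pe orbT.
Qed.

Lemma card_spanning_seq q : uniq q -> (forall y, y \in q) -> #|T| = size q.
Proof. by move=> Uq all_q; rewrite -(card_uniqP Uq); apply/eq_card=> y; rewrite all_q. Qed.

(** The new cycle gives up two links of the old sequence: the pair of [last z q1] and [b], which is
    not on the path by hypothesis, and the pair of [last b q2] and [z], which is not an edge of [H].
    The path therefore survives. *)
Lemma cycle_exchange H x p z q1 b q2 : 0 < size (q1 ++ q2) ->
    uniq (z :: q1 ++ b :: q2) -> (forall y, y \in z :: q1 ++ b :: q2) ->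
    path H z q1 -> path H b q2 -> H z b -> H (last z q1) (last b q2) ->
    ~~ H z (last b q2) -> path H x p ->
    [set last z q1; b] \notin path_edges x p ->
    path (cycle_adj (z :: q1 ++ b :: q2)) x p ->
  exists2 c, hamiltonian_cycle H c & path (cycle_adj c) x p.
Proof.
move=> s_gt0 Us all_s Hq1 Hq2 Hzb Hay nHzy Hp nabp.
set s := z :: _ in Us all_s * => Ps; set c := z :: q1 ++ rev (b :: q2).
have perm_c : perm_eq c s by rewrite perm_cons perm_cat2l perm_rev.
have Uc : uniq c by rewrite (perm_uniq perm_c).
exists c.
  split=> //; first by rewrite cycle_cat_rev ?Hq1 ?Hay ?Hq2 //; apply: adj_sym.
    by rewrite (perm_size perm_c); move: s_gt0; rewrite /= !size_cat /=; lia.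
  by move=> y; rewrite (perm_mem perm_c).
have := cycle_cycle_adj Uc; rewrite cycle_cat_rev; last exact: cycle_adj_sym.
case/and4P=> c1 _ c2 _.
have c_s y w : H y w -> [set y; w] != [set last z q1; b] -> next s y == w -> cycle_adj c y w.
  (* [r] relaxes [cycle_adj c] by the two links given up, so that it holds all along [s]. *)
  pose r y w := [|| cycle_adj c y w, ~~ H y w | [set y; w] == [set last z q1; b]].
  have /next_cycle r_next : cycle r s.
    rewrite cycle_cat /r eqxx !orbT (adj_sym H _ z) nHzy orbT.
    by apply/and4P; split=> //; [apply: sub_path c1 | apply: sub_path c2] => ? ? ->.
  move=> Hyw ne /eqP def_w; have := r_next y (all_s y).
  by rewrite def_w /r Hyw (negPf ne) !orbF.
pose r := [rel y w | H y w && cycle_adj s y w].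
have : path [rel y w | r y w && [rel y w | [set y; w] \in path_edges x p] y w] x p.
  by rewrite !path_relI Hp Ps path_path_edges.
apply: sub_path => y w /= /andP[/andP[Hyw /orP[]next_s] pyw].
  by apply: c_s => //; apply: contraNneq nabp => <-.
rewrite cycle_adj_sym; apply: c_s; rewrite 1?adj_sym //.
by rewrite setUC; apply: contraNneq nabp => <-.
Qed.

(** Ore's pigeonhole argument: [I1] and [I2] have total size at least [#|T| + size p] among
    [#|T| - 1] positions, so they share more than [size p] positions, and the path blocks at most
    [size p] of these. *)
Lemma exists_crossing H x p z q : uniq (z :: q) -> (forall y, y \in z :: q) ->
    #|T| + size p <= degree H z + degree H (last z q) ->
  exists i, [/\ i < size q, H z (nth z q i), H (last z q) (nth z (z :: q) i)
    & [set nth z (z :: q) i; nth z q i] \notin path_edges x p].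
Proof.
move=> Uzq all_q; set y := last z q; set m := size q => le_deg.
have cT : #|T| = m.+1 := card_spanning_seq Uzq all_q.
pose a (i : 'I_m) := nth z (z :: q) i; pose b (i : 'I_m) := nth z q i.
pose I1 := [set i | H z (b i)]; pose I2 := [set i | H y (a i)].
pose I3 := [set i | [set a i; b i] \in path_edges x p].
have le1 : degree H z <= #|I1|.
  apply: leq_trans (leq_imset_card b I1); apply/subset_leq_card/subsetP=> w.
  rewrite inE => Hzw; have := all_q w; rewrite inE; case: eqP Hzw => [->|_ Hzw /= qw].
    by rewrite adj_irr.
  have lt_i : index w q < m by rewrite index_mem.
  by apply/imsetP; exists (Ordinal lt_i); rewrite ?inE /b /= nth_index.
have le2 : degree H y <= #|I2|.
  apply: leq_trans (leq_imset_card a I2); apply/subset_leq_card/subsetP=> w.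
  rewrite inE => Hyw; have lt_i : index w (z :: q) < m.
    have : index w (z :: q) <= m by rewrite -ltnS -[m.+1]/(size (z :: q)) index_mem.
    rewrite leq_eqVlt => /orP[/eqP eq_m|//].
    have : y = w by rewrite /y (last_nth z) -/m -eq_m nth_index.
    by move=> eyw; rewrite eyw adj_irr in Hyw.
  by apply/imsetP; exists (Ordinal lt_i); rewrite ?inE /a ?nth_index.
have inj_ab i j : [set a i; b i] = [set a j; b j] -> i <= j.
  move=> eq_ab; rewrite leqNgt; apply/negP=> ltji.
  have : a j \in [set a i; b i] by rewrite eq_ab set21.
  have bE : b i = nth z (z :: q) i.+1 by [].
  have [lti ltj] := (ltn_ord i, ltn_ord j).
  have sz : size (z :: q) = m.+1 by [].
  by rewrite !inE bE /a !nth_uniq // ?sz; lia.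
have le3 : #|I3| <= size p.
  have inj : injective (fun i => [set a i; b i]).
    by move=> i j eq_ab; apply/val_inj/eqP; rewrite eqn_leq !inj_ab.
  rewrite -(card_imset _ inj) -(size_pairmap (fun y z => [set y; z]) x p).
  apply: leq_trans (card_size _); apply/subset_leq_card/subsetP=> e /imsetP[i].
  by rewrite inE => pi ->.
have /card_gt0P[i] : 0 < #|(I1 :&: I2) :\: I3|.
  have := cardsUI I1 I2; have := cardsID I3 (I1 :&: I2).
  have := max_card (I1 :|: I2); rewrite card_ord.
  have := subset_leq_card (subsetIr (I1 :&: I2) I3); lia.
by rewrite !inE => /andP[nI3 /andP[Hb Ha]]; exists i; split.
Qed.

Lemma hamiltonian_path_close H x p z q : 2 < #|T| -> uniq (z :: q) ->
    (forall y, y \in z :: q) -> path H z q -> ~~ H z (last z q) ->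
    path H x p -> path (cycle_adj (z :: q)) x p ->
    #|T| + size p <= degree H z + degree H (last z q) ->
  exists2 c, hamiltonian_cycle H c & path (cycle_adj c) x p.
Proof.
move=> T_gt2 Uq all_q Hq nHz Hp pq le_deg.
have [i [ltiq Hb Ha nabp]] := exists_crossing x Uq all_q le_deg.
have cT : #|T| = (size q).+1 := card_spanning_seq Uq all_q.
have aE : nth z (z :: q) i = last z (take i q).
  by rewrite (last_nth z) size_takel 1?ltnW // -[z :: take i q]/(take i.+1 (z :: q)) nth_take.
have def_q : q = take i q ++ nth z q i :: drop i.+1 q by rewrite -drop_nth // cat_take_drop.
move: aE def_q nabp Ha Hb; set b := nth z q i; set q1 := take i q; set q2 := drop _ _.
move=> -> def_q nabp Ha Hb; rewrite def_q in Uq all_q Hq nHz pq Ha cT.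
rewrite last_cat /= in nHz Ha; move: Hq; rewrite cat_path /= => /and3P[Hq1 _ Hq2].
apply: (@cycle_exchange H x p z q1 b q2) => //; last by rewrite adj_sym.
by move: cT T_gt2; rewrite !size_cat /=; lia.
Qed.
End HamiltonianCycles.

(** * Stability under the Bondy-Chvatal closure *)

Section Closure.
Variable T : finType.
Implicit Types (G H : sgraph T) (c p q : seq T) (x y z u v w : T).

Definition add_edge_adj H u v : rel T :=
  fun x y => H x y || (x != y) && (((x, y) == (u, v)) || ((y, x) == (u, v))).

Fact add_edge_sym H u v : symmetric (add_edge_adj H u v).
Proof.
by move=> x y; rewrite /add_edge_adj adj_sym eq_sym [X in _ && X]orbC.
Qed.

Fact add_edge_irr H u v : irreflexive (add_edge_adj H u v).
Proof. by move=> x; rewrite /add_edge_adj adj_irr eqxx. Qed.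

Definition add_edge H u v := SGraph (@add_edge_sym H u v) (@add_edge_irr H u v).

(** Rotated to start at [next c y], the cycle becomes a Hamiltonian path of [H] ending at [y], to
    which [hamiltonian_path_close] applies. *)
Lemma hamiltonian_cycle_replace H x p c y : uniq c -> 2 < size c -> (forall w, w \in c) ->
    ~~ H y (next c y) -> (forall w, w != y -> H w (next c w)) ->
    path H x p -> path (cycle_adj c) x p ->
    #|T| + size p <= degree H y + degree H (next c y) ->
  exists2 c', hamiltonian_cycle H c' & path (cycle_adj c') x p.
Proof.
move=> Uc c_gt2 all_c nHy Hnext Hp cp le_deg.
have [i q def_q] := rot_to (all_c (next c y)).
have Uq : uniq (next c y :: q) by rewrite -def_q rot_uniq.
have all_q w : w \in next c y :: q by rewrite -def_q mem_rot.
have next_q w : next (next c y :: q) w = next c w by rewrite -def_q next_rot.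
have := cycle_next Uq; rewrite /= rcons_path => /andP[next_path /eqP].
have inj_next : injective (next c) := can_inj (prev_next Uc).
rewrite next_q => /inj_next last_q.
apply: (@hamiltonian_path_close T H x p (next c y) q) => //.
- by rewrite (card_spanning_seq Uc all_c).
- apply/(pathP y)=> j lt_j; have /(pathP y)/(_ j lt_j)/eqP := next_path.
  rewrite next_q => <-; apply: Hnext.
  apply/eqP=> eq_y; have lastE : nth y (next c y :: q) (size q) = y by rewrite -last_nth.
  have lt_q i' : i' <= size q -> i' < size (next c y :: q) by [].
  have := nth_uniq y (lt_q j (ltnW lt_j)) (lt_q _ (leqnn _)) Uq.
  by rewrite lastE eq_y eqxx => /esym/eqP ej; rewrite ej ltnn in lt_j.
- by rewrite last_q adj_sym.
- by rewrite -def_q (eq_path (cycle_adj_rot i Uc)).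
by rewrite last_q [X in _ <= X]addnC.
Qed.

Lemma hamiltonian_cycle_remove_edge H u v x p c : u != v -> path H x p ->
    #|T| + size p <= degree H u + degree H v ->
    hamiltonian_cycle (add_edge H u v) c -> path (cycle_adj c) x p ->
  exists2 c', hamiltonian_cycle H c' & path (cycle_adj c') x p.
Proof.
move=> neq_uv Hp le_deg [cyc_c Uc c_gt2 all_c] cp.
have next_uv w : ~~ H w (next c w) -> (w, next c w) = (u, v) \/ (w, next c w) = (v, u).
  move=> nH; have := next_cycle cyc_c (all_c w); rewrite /= /add_edge_adj (negPf nH) /=.
  by case/andP=> _ /orP[]/eqP[-> ->]; auto.
case: (pickP (fun y => ~~ H y (next c y))) => [y nHy|Hc]; last first.
  exists c => //; split=> //; apply: sub_cycle (cycle_next Uc) => y z /= /eqP <-.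
  by apply/negPn; rewrite Hc.
apply: (@hamiltonian_cycle_replace H x p c y) => //.
  (* A second step outside [H] would use the pair [u], [v] again: in the same direction it starts at
     [y], in the other it makes [next c] return to [y] after two steps. *)
  move=> w neq_wy; apply/negPn/negP=> /next_uv next_w.
  have nn := next_next_neq Uc c_gt2 (all_c y).
  case: (next_uv y nHy) => -[ey eny]; case: next_w => -[ew enw].
  - by rewrite ey ew eqxx in neq_wy.
  - by rewrite eny -ew enw ey eqxx in nn.
  - by rewrite eny -ew enw ey eqxx in nn.
  - by rewrite ey ew eqxx in neq_wy.
by case: (next_uv y nHy) => -[-> ->] //; rewrite [X in _ <= X]addnC.
Qed.

Lemma complete_hamiltonian H x p : 2 < #|T| -> (forall y z, y != z -> H y z) ->
  uniq (x :: p) -> exists2 c, hamiltonian_cycle H c & path (cycle_adj c) x p.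
Proof.
move=> T_gt2 H_complete Up; set c := (x :: p) ++ filter [predC x :: p] (enum T).
have Uc : uniq c.
  rewrite cat_uniq Up filter_uniq ?enum_uniq // andbT; apply/hasPn=> y.
  by rewrite mem_filter => /andP[].
have all_c y : y \in c by rewrite mem_cat mem_filter mem_enum andbT /= orbN.
have c_gt2 : 2 < size c by rewrite -(card_spanning_seq Uc all_c).
exists c; last first.
  by have := cycle_cycle_adj Uc; rewrite /c /= rcons_cat cat_path => /andP[].
split=> //; apply: sub_cycle (cycle_next Uc) => y z /eqP <-; apply: H_complete.
by apply/eqP=> eq_y; have := next_next_neq Uc c_gt2 (all_c y); rewrite -!eq_y eqxx.
Qed.

(* Chvatal's degree condition: in the closure of [H] under joining pairs of degree sum at least
   [#|T| + size p], a nonadjacent pair [u], [v] of maximal degree sum with [degree u <= degree v]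
   yields [h := degree u] and the set [A] of the non-neighbours of [v]. *)
Lemma hamiltonian_or_low_degree H x p : 2 < #|T| -> is_path H x p ->
  (exists2 c, hamiltonian_cycle H c & path (cycle_adj c) x p) \/
  exists h (A : {set T}), [/\ 0 < #|A|, h <= size p + #|A|, h.*2 < #|T| + size p
    & {in A, forall w, degree H w <= h}].
Proof.
move=> T_gt2.
pose nonadj H := [set uv : T * T | (uv.1 != uv.2) && ~~ H uv.1 uv.2].
move: {2}#|nonadj H| (leqnn #|nonadj H|) => m; elim: m H => [|m IHm] H le_m [Hp Up].
  left; apply: complete_hamiltonian => // y z neq_yz.
  move: le_m; rewrite leqn0 cards_eq0 => /eqP/setP/(_ (y, z)).
  by rewrite !inE /= neq_yz => /negbFE.
pose joinable uv := #|T| + size p <= degree H uv.1 + degree H uv.2.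
case: (pickP [pred uv in nonadj H | joinable uv]) => [[u v]|closed].
  rewrite !inE /= => /andP[/andP[neq_uv nHuv] le_deg].
  have subH : subrel H (add_edge H u v) by move=> y z /= Hyz; rewrite /add_edge_adj Hyz.
  have [||[c Hc cp]|[h [A [A_gt0 leA le_h degA]]]] := IHm (add_edge H u v).
  - rewrite -ltnS; apply: leq_trans le_m; apply/proper_card/properP; split.
      apply/subsetP=> -[y z]; rewrite !inE /= => /andP[-> /=].
      by apply: contra => /subH.
    by exists (u, v); rewrite !inE /= ?neq_uv ?nHuv // /add_edge_adj eqxx /= neq_uv orbT.
  - by split=> //; apply: sub_path Hp.
  - by left; apply: hamiltonian_cycle_remove_edge Hc cp.
  (* Degrees only grow when an edge is added, so the same [h] and [A] serve for [H]. *)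
  right; exists h, A; split=> // w /degA; apply: leq_trans.
  by apply/subset_leq_card/subsetP=> y; rewrite !inE => /subH.
case: (pickP (mem (nonadj H))) => [uv0 uv0P|complete_H]; last first.
  left; apply: complete_hamiltonian => // y z neq_yz.
  by have := complete_H (y, z); rewrite !inE /= neq_yz => /negbFE.
case: (arg_maxnP (fun uv => degree H uv.1 + degree H uv.2) uv0P) => -[u0 v0] uv0nadj max0.
have [u [v [uv_nadj le_uv max_uv]]] : exists u v, [/\ (u, v) \in nonadj H,
    degree H u <= degree H v & forall u' v', (u', v') \in nonadj H ->
    degree H u' + degree H v' <= degree H u + degree H v].
  case: (leqP (degree H u0) (degree H v0)) => le0.
    by exists u0, v0; split=> // u' v' /max0.
  exists v0, u0; split=> [||u' v' /max0]; [|exact: ltnW|by rewrite addnC].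
  by move: uv0nadj; rewrite !inE /= adj_sym eq_sym.
have := closed (u, v); rewrite inE uv_nadj /= => /negbT; rewrite /joinable /= -ltnNge => lt_deg.
move: (uv_nadj); rewrite inE /= => /andP[neq_uv nHuv].
(* Here [#|A| = #|T| - 1 - degree H v], so both bounds on [h] restate that the pair is not joinable;
   maximality of the degree sum bounds the degrees on [A]. *)
right; exists (degree H u), (~: (v |: nbhd H v)).
have := cardsC (v |: nbhd H v); rewrite cardsU1 inE adj_irr -/(degree H v) /= => cA.
split; last 1 [move=> w]; try lia.
  by apply/card_gt0P; exists u; rewrite !inE negb_or neq_uv adj_sym.
rewrite !inE negb_or => /andP[neq_wv nHvw].
by rewrite -(leq_add2r (degree H v)) max_uv // inE /= neq_wv adj_sym.
Qed.

End Closure.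

(** * The extremal bound *)

Section EdgeBounds.
Variables (T : finType) (G : sgraph T).
Implicit Types (A B X : {set T}).

Lemma clique_freeW m B : clique_free m G -> clique_free_in G m B.
Proof. by move=> freeG A _; apply: freeG. Qed.

Lemma num_edges_delete r h A : 0 < r -> clique_free r.+1 G ->
    {in A, forall w, degree G w <= h} ->
  num_edges G <= turan_size r (#|T| - #|A|) + #|A| * h.
Proof.
move=> r_gt0 freeG degA; rewrite -leq_double -arcs_double_edges doubleD.
apply: leq_trans (arcs_delete_le G (subsetT (~: A))) _.
rewrite setTD setCK; apply: leq_add.
  have -> : #|T| - #|A| = #|~: A| by rewrite [RHS]cardsCs setCK.
  by apply: turan_bound => //; apply: clique_freeW.
rewrite leq_double -sum_nat_const; apply: leq_sum => w Aw.
by rewrite degree_in_setT degA.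
Qed.

(* With [X = ~: A] and [d] the largest number of neighbours in [X] of a vertex [v], Mantel's theorem
   for the triangle-free set [N(v) :&: X] gives
   [2 e(G) <= #|A| h + #|A| d + d^2 / 2 + 2 (#|X| - d) d], which is maximal for
   [d = (2 #|T| - #|A|) / 3]. *)
Lemma num_edges_K4_free h A : clique_free 4 G -> {in A, forall w, degree G w <= h} ->
  12 * num_edges G <= 6 * (#|A| * h) + (2 * #|T| - #|A|) ^ 2.
Proof.
move=> freeG degA; set X := ~: A.
case: (pickP (fun _ : T => true)) => [v0 _|T0]; last first.
  have -> // : num_edges G = 0.
  by apply/double_inj; rewrite -arcs_double_edges /arcs big_pred0 // => x; have := T0 x.
case: (@arg_maxnP _ v0 predT (degree_in G X)) => // v _ max_v.
set d := degree_in G X v in max_v; set N := X :&: nbhd G v.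
have cN : #|N| = d by rewrite /d degree_in_card.
have cX : #|X| = #|T| - #|A| by rewrite cardsCs setCK.
have leN : d <= #|X| by rewrite -cN subset_leq_card ?subsetIl.
have freeN : clique_free_in G 3 N.
  move=> B sBN cB clB; apply: (freeG (v |: B)).
    rewrite cardsU1 cB; case: (boolP (v \in B)) => // /(subsetP sBN).
    by rewrite !inE adj_irr andbF.
  by apply: (is_cliqueU1 clB) => a /(subsetP sBN); rewrite !inE adj_sym => /andP[].
have le_arcsN : 2 * arcs G N <= d ^ 2.
  have := turan_bound (isT : 0 < 2) freeN; have := turan_sizeE d (isT : 0 < 2).
  rewrite cN mul1n => <- le_arcs; apply: leq_trans (leq_addr _ _).
  by rewrite -mulnA leq_mul2l /= mul2n.
have le_arcsX : arcs G X <= arcs G N + 2 * ((#|X| - d) * d).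
  apply: leq_trans (arcs_delete_le G (subsetIl _ _ : N \subset X)) _.
  have -> : #|X| - d = #|X :\: N| by rewrite cardsD (setIidPr (subsetIl _ _)) cN.
  rewrite -mul2n leq_add2l leq_mul2l /=.
  by rewrite -sum_nat_const; apply: leq_sum => w _; apply: (max_v w).
have le_arcsT : arcs G setT <= arcs G X + #|A| * (d + h).
  rewrite (arcs_split G (subsetT X)) leq_add2l setTD setCK -sum_nat_const.
  by apply: leq_sum => w Aw; rewrite leq_add ?degree_in_setT ?degA //; apply: (max_v w).
have leA : #|A| <= #|T| := max_card _.
have [e eX] : exists e, #|X| = d + e by exists (#|X| - d); lia.
have -> : 2 * #|T| - #|A| = #|A| + 2 * (d + e) by rewrite -eX cX; lia.
have := arcs_double_edges G.
move: le_arcsN le_arcsX le_arcsT; have -> : #|X| - d = e by lia.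
clearbody d; move: (#|A|) (arcs _ _) (arcs _ _) (arcs _ _) => s aT aX aN leaN leaX leaT eT.
rewrite -!mulnn in leaN *.
have {}leaT : 6 * aT <= 6 * aX + 6 * (s * d) + 6 * (s * h) by lia.
have {}leaX : 6 * aX <= 6 * aN + 12 * (e * d) by lia.
have {}leaN : 6 * aN <= 3 * (d * d) by lia.
(* With [u = s + 2 * e], the right side minus the left side is [(u - d) ^ 2]. *)
have sq : 6 * (s * d) + 3 * (d * d) + 12 * (e * d) <= (s + 2 * (d + e)) * (s + 2 * (d + e)).
  by have := (nat_Cauchy (s + 2 * e) d).1; rewrite -!mulnn; lia.
by rewrite -muln2 in eT; lia.
Qed.

End EdgeBounds.

(** * Numerical consequences of the order condition *)

(** With [s = 2] the inequality is false, because [12 * turan_size 3 n.-1 <= 4 * n.-1 ^ 2]. The left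
    side is convex in [s], so the critical values are [s = 3] and [s] just below [(n - k) / 2]. *)
Lemma large_order_K4 n k s : 6 * k + 26 <= n -> 2 < s -> (k + s).*2 < n + k ->
  6 * (s * (k + s)) + (2 * n - s) ^ 2 <= 12 * (turan_size 3 n.-1 + k.+1).
Proof.
move=> le_n s_gt2 lt_s; have := turan_sizeE n.-1 (isT : 0 < 3).
have := ltn_pmod n.-1 (isT : 0 < 3); move: (n.-1 %% 3) (turan_size _ _) => j t ltj e.
have [m en] : exists m, n = m.+1 by exists n.-1; lia.
rewrite en /= in e le_n lt_s *.
have le_t : 6 * t + 2 >= 2 * m ^ 2 by case: j ltj e => [|[|[|]]] //= _; lia.
have [d em] : exists d, 2 * m + 2 = s + d by exists (2 * m.+1 - s); lia.
have -> : 2 * m.+1 - s = d by lia.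
have : 6 * (s * (k + s)) + d ^ 2 <= 4 * m ^ 2 + 12 * k + 8.
  have -> : d = 2 * m + 2 - s by lia.
  have [w ew] : exists w, s = w + 3 by exists (s - 3); lia.
  nia.
lia.
Qed.

(** The condition of [turan_size_gap] would read [5 * k + 17 <= n] at [r = 4]. The exact count
    [turan_sizeE] does better: its error of at most 4, against a factor 8, disappears by
    integrality. *)
Lemma turan_size4_gap n k s : 5 * k + 11 <= n -> 0 < s -> (k + s).*2 < n + k ->
  turan_size 4 (n - s) + s * (k + s) <= turan_size 4 n.-1 + k.+1.
Proof.
move=> le_n s_gt0 lt_s.
have [w es] : exists w, s = w.+1 by exists s.-1; lia.
have [m en] : exists m, n = m + w.+1 by exists (n - s); lia.
rewrite es en in le_n lt_s *; have -> : m + w.+1 - w.+1 = m by lia.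
have -> : (m + w.+1).-1 = m + w by lia.
have et : 8 * turan_size 4 m <= 3 * m ^ 2.
  by rewrite -(turan_sizeE m (isT : 0 < 4)) leq_addr.
have et' : 3 * (m + w) ^ 2 <= 8 * turan_size 4 (m + w) + 4.
  rewrite -(turan_sizeE (m + w) (isT : 0 < 4)) leq_add2l.
  by case: (_ %% 4) (ltn_pmod (m + w) (isT : 0 < 4)) => [|[|[|[|]]]].
move: (turan_size 4 m) (turan_size 4 (m + w)) et et' => t t' et et'.
have : 8 * (w * (k + w + 2)) <= 3 * (w * (2 * m + w)).
  (* At the extreme [2 * w = n - k - 3], with [n = m + w.+1], this is precisely
     [5 * k + 11 <= n]. *)
  have : 8 * (k + w + 2) <= 3 * (2 * m + w) by lia.
  by move/(leq_mul (leqnn w)); lia.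
rewrite -!mulnn in et et' *; lia.
Qed.

(** After [s = w.+1] the claim follows from [w] times the linear inequality [key]; the hypothesis on
    [n] is [key] at the extreme [2 * w = n - k - 3]. *)
Lemma turan_size_gap r n k s : 4 < r -> k * r.+1 + 5 * r <= n * (r - 3) + 3 ->
    0 < s -> (k + s).*2 < n + k ->
  turan_size r (n - s) + s * (k + s) <= turan_size r n.-1 + k.+1.
Proof.
move=> r_gt4 le_n s_gt0 lt_s.
have [w es] : exists w, s = w.+1 by exists s.-1; lia.
have [m en] : exists m, n = m + w.+1 by exists (n - s); lia.
rewrite es en in le_n lt_s *; have -> : m + w.+1 - w.+1 = m by lia.
have -> : (m + w.+1).-1 = m + w by lia.
have := @turan_size_increment r m w (ltnW (ltnW (ltnW (ltnW r_gt4)))).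
move: (turan_size _ _) (turan_size _ _) => t' t.
have [q er] : exists q, r = q + 5 by exists (r - 5); lia.
have e1 : r.-1 = q + 4 by lia.
have e2 : r - 3 = q + 2 by lia.
rewrite e1; rewrite e2 er in le_n * => le_t {e1 e2 er r_gt4 r en es n s s_gt0}.
have key : 2 * (q + 5) * (k + w + 2) + (q + 4) <= (q + 4) * (2 * m + w).
  have [d ed] : exists d, m = k + w + 2 + d by exists (m - (k + w + 2)); lia.
  by rewrite ed in le_n *; nia.
have := leq_mul (leqnn w) key => {}key.
have q5_gt0 : 0 < 2 * (q + 5) by lia.
rewrite -(leq_pmul2l q5_gt0).
lia.
Qed.

(** The rational order condition with the denominator [r - 4] cleared. *)
Definition large_order r k n :=
  if r == 3 then 6 * k + 26 <= n
  else if r <= 7 then 5 * k + 11 <= n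
  else (k + 5) * (r - 4) + 4 * (k + 4) <= n * (r - 4).

(** This leaves room for the [k.+1] neighbours chosen by [skip_last] among the [n.-1] vertices of
    the Turan graph. *)
Lemma large_order_gt r k n : 3 <= r -> large_order r k n -> (k + k %/ r.-1).+2 < n.
Proof.
move=> r_ge3; have := leq_divM k r.-1; have := leq_div k r.-1.
rewrite /large_order; move: (k %/ _) => t le_tk le_t.
case: eqP => [_|_]; first by lia.
case: (leqP r 7) => [_|r_gt7]; first by lia.
have [q er] : exists q, r = q.+4 by exists (r - 4); lia.
rewrite er in le_t r_gt7 *; have -> : q.+4 - 4 = q by lia.
move=> le_n; have q_gt0 : 0 < q by lia.
suff : k + 5 + t <= n by lia.
rewrite -(leq_pmul2r q_gt0); apply: leq_trans le_n; rewrite [leqLHS]mulnDl leq_add2l.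
have : t * q <= t * q.+3 by rewrite leq_mul2l; lia.
by move: le_t => /=; lia.
Qed.

Lemma large_order_sparse r k n : 4 < r -> large_order r k n ->
  k * r.+1 + 5 * r <= n * (r - 3) + 3.
Proof.
move=> r_gt4; rewrite /large_order; case: eqP => [|_]; first by lia.
case: (leqP r 7) => [r_le7 le_n|r_gt7].
  by move: r r_gt4 r_le7 => [|[|[|[|[|[|[|[|r]]]]]]]] //= _ _; lia.
have [q er] : exists q, r = q.+4 by exists (r - 4); lia.
rewrite er; have -> : q.+4 - 4 = q by lia.
have -> : q.+4 - 3 = q.+1 by lia.
move=> le_n; have q_gt0 : 0 < q by lia.
(* The order condition amounts to [k * r + 5 * r <= n * (r - 4) + 4]; adding [k + 5 <= n] gives the
   goal. *)
have le_kn : k + 5 <= n by rewrite -(leq_pmul2r q_gt0); lia.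
by rewrite mulnS; lia.
Qed.

Lemma exists_subset_card (T : finType) (A : {set T}) s : s <= #|A| ->
  exists2 B : {set T}, B \subset A & #|B| = s.
Proof.
move=> le_s; exists [set x in take s (enum A)].
  by apply/subsetP=> x; rewrite inE => /mem_take; rewrite mem_enum.
rewrite cardsE (card_uniqP _) ?take_uniq ?enum_uniq // size_takel // -cardE //.
Qed.

Lemma num_edges_not_path_hamiltonian (T : finType) (G : sgraph T) r k : 3 <= r ->
    large_order r k #|T| -> clique_free r.+1 G -> ~ path_hamiltonian k G ->
  num_edges G <= turan_size r #|T|.-1 + k.+1.
Proof.
move=> r_ge3 le_n freeG; have := large_order_gt r_ge3 le_n; set n := #|T| in le_n * => lt_n.
apply: contra_notT; rewrite -ltnNge => gt_bound x p Pp le_p.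
have n_gt2 : 2 < n by apply: leq_ltn_trans lt_n.
have [//|[h [A [A_gt0 le_h lt_h degA]]]] := hamiltonian_or_low_degree n_gt2 Pp.
rewrite -/n in lt_h; suff : num_edges G <= turan_size r n.-1 + k.+1 by lia.
have r_gt0 : 0 < r by lia.
case: (leqP h k.+1) => [le_hk|lt_kh].
  have [B sBA cB] := exists_subset_card A_gt0.
  have := num_edges_delete r_gt0 freeG (sub_in1 (subsetP sBA) degA).
  by rewrite cB -/n subn1; lia.
have [|B sBA cB] := @exists_subset_card _ A (h - k); first by lia.
have {}degA := sub_in1 (subsetP sBA) degA.
have [s es] : exists s, h = k + s by exists (h - k); lia.
have eks : k + s - k = s by lia.
rewrite es eks in cB degA lt_h lt_kh.
have lt_s : (k + s).*2 < n + k by lia.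
have := num_edges_delete r_gt0 freeG degA; rewrite cB -/n => le_e.
case: (ltngtP r 4) => [r_lt4|r_gt4|r4].
- have r3 : r = 3 by lia.
  rewrite r3 in freeG le_e le_n *; rewrite /large_order /= in le_n.
  case: (ltnP 2 s) => [s_gt2|s_le2].
    have := num_edges_K4_free freeG degA; have := large_order_K4 le_n s_gt2 lt_s.
    by rewrite cB -/n; lia.
  have s2 : s = 2 by lia.
  have [m en] : exists m, n = m.+2 by exists n.-2; lia.
  move: le_e; rewrite s2 en /= turan_sizeS subn2 /=; lia.
- have := turan_size_gap r_gt4 (large_order_sparse r_gt4 le_n) _ lt_s; lia.
rewrite r4 /large_order /= in le_n; rewrite r4 in le_e *.
have := turan_size4_gap le_n _ lt_s; lia.
Qed.

(** * The extremal family *)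

Section JFamily.
Variables (T : finType) (G : sgraph T).
Implicit Types (x y z v w : T) (c p q : seq T) (A : {set T}).

Lemma traceable_inducedP A : traceable (induced G A) <->
  exists x p, [/\ is_path G x p & x :: p =i A].
Proof.
split=> [[x [p [[Gp Up] all_p]]]|[x [p [[Gp Up] pA]]]].
  exists (val x), (map val p); split.
    by split; [rewrite path_map | rewrite -map_cons map_inj_uniq //; exact: val_inj].
  move=> y; rewrite -map_cons; apply/mapP/idP=> [[z _ ->]|Ay]; first exact: valP.
  by exists (exist _ y Ay).
have /all_sigP[] : all (fun y => y \in A) (x :: p) by apply/allP=> y; rewrite pA.
case=> // x' p' [ex ep]; exists x', p'; rewrite ex ep in Gp Up pA.
split; first split.
- by rewrite path_map in Gp.
- by rewrite -map_cons map_inj_uniq // in Up; exact: val_inj.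
by move=> y; rewrite -(mem_map val_inj) map_cons pA; apply: valP.
Qed.

Lemma arcs_induced (m : nat) (H : sgraph 'I_m) A :
  isomorphic H (induced G A) -> arcs G A = (num_edges H).*2.
Proof.
case=> f bij_f fG; rewrite -arcs_double_edges.
have inj_g : injective (val \o f) by apply: inj_comp val_inj (bij_inj bij_f).
have -> : A = (val \o f) @: setT.
  apply/setP=> x; apply/idP/imsetP=> [Ax|[i _ ->]]; last exact: valP.
  have [g _ gK] := bij_f; exists (g (exist _ x Ax)) => //.
  by rewrite /comp gK.
rewrite /arcs /degree_in big_imset /=; last by move=> i j _ _; apply: inj_g.
apply: eq_bigr => i _; rewrite big_imset /=; last by move=> ? ? _ _; apply: inj_g.
by apply: eq_bigr => j _; rewrite -fG.
Qed.

Lemma num_edges_del1 v (m : nat) (H : sgraph 'I_m) :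
  isomorphic H (induced G [set~ v]) -> num_edges G = num_edges H + degree G v.
Proof.
move=> /arcs_induced arcs_v; apply: double_inj; rewrite -arcs_double_edges doubleD -arcs_v.
rewrite (arcs_split G (subsetT [set~ v])) setTD setCK big_set1 degree_in_setT -addnn.
congr (_ + (_ + _)); rewrite degree_in_card; apply: eq_card => w; rewrite !inE.
by case: eqP => [->|]; rewrite ?adj_irr.
Qed.

Lemma fpath_next_in (f : T -> T) x p y : fpath f x p -> y \in x :: p ->
  y = last x p \/ f y \in p.
Proof.
elim: p x => [|z p IHp] x /=; first by rewrite inE => _ /eqP; left.
case/andP=> /eqP <- fp; rewrite inE => /orP[/eqP->|]; first by right; rewrite mem_head.
by case/(IHp _ fp) => fy; [left | right; rewrite inE fy orbT].
Qed.

Lemma fpath_closed (f : T -> T) (S : {pred T}) x p : {in S, forall y, f y \in S} ->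
  fpath f x p -> x \in S -> {subset x :: p <= S}.
Proof.
move=> closedS; elim: p x => [|z p IHp] x /=; first by move=> _ Sx y; rewrite inE => /eqP->.
case/andP=> /eqP <- fp Sx y; rewrite inE => /orP[/eqP->//|].
by apply: IHp fp _ y; apply: closedS.
Qed.

(** A path with distinct vertices cannot turn back on the cycle: after a step by [next c], a step by
    [prev c] would revisit a vertex. *)
Lemma cycle_adj_fpath c x p : uniq c -> uniq (x :: p) -> path (cycle_adj c) x p ->
  fpath (next c) x p \/ fpath (prev c) x p.
Proof.
move=> Uc; elim: p x => [|y p IHp] x; first by left.
rewrite /= => /andP[] xp Up /andP[adj_xy cp].
have {adj_xy} [exy|exy] : next c x = y \/ prev c x = y.
- by case/orP: adj_xy => /eqP <-; rewrite ?(prev_next Uc); auto.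
- case: (IHp y Up cp) => fp; first by left; rewrite exy eqxx.
  case: p xp {IHp Up cp} fp => [|z p] xp /=; first by left; rewrite exy eqxx.
  by rewrite -exy prev_next // => /andP[/eqP ez _]; rewrite ez !inE eqxx orbT in xp.
case: (IHp y Up cp) => fp; last by right; rewrite exy eqxx.
case: p xp {IHp Up cp} fp => [|z p] xp /=; first by right; rewrite exy eqxx.
by rewrite -exy next_prev // => /andP[/eqP ez _]; rewrite ez !inE eqxx orbT in xp.
Qed.

(** Since [v] is off the path, its predecessor must be the last vertex; so [v :: x :: p] is closed
    under [next c] and exhausts the cycle. *)
Lemma spanning_fpath_size c v x p : uniq c -> (forall y, y \in c) -> fpath (next c) x p ->
  v \notin x :: p -> next c v \in x :: p -> prev c v \in x :: p -> #|T| <= (size p).+2.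
Proof.
move=> Uc all_c fp nv next_v prev_v.
have next_last : next c (last x p) = v.
  case: (fpath_next_in fp prev_v) => [<-|]; first by rewrite next_prev.
  by rewrite next_prev // => pv; rewrite inE pv orbT in nv.
have closed y : y \in v :: x :: p -> next c y \in v :: x :: p.
  rewrite inE => /orP[/eqP->|/(fpath_next_in fp)[->|py]]; first by rewrite inE next_v orbT.
    by rewrite next_last mem_head.
  by rewrite !inE py !orbT.
have [i q def_q] := rot_to (all_c v).
have Uq : uniq (v :: q) by rewrite -def_q rot_uniq.
have all_q y : y \in v :: q by rewrite -def_q mem_rot.
rewrite (card_spanning_seq Uq all_q); apply: (@uniq_leq_size _ (v :: q) (v :: x :: p)) => //.
apply: (@fpath_closed (next c)) => //; last by rewrite mem_head.
have := cycle_next Uc; rewrite -(rot_cycle i) def_q /= rcons_path.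
by case/andP.
Qed.

End JFamily.

(* The neighbours of [v] form a path of length [k]; on a Hamiltonian cycle through it, both cycle
   neighbours of [v] are ends of that path, which closes up a cycle on [k + 2] vertices. *)
Lemma not_path_hamiltonian (T : finType) (G : sgraph T) k v : k.+2 < #|T| ->
  degree G v = k.+1 -> traceable (induced G (nbhd G v)) -> ~ path_hamiltonian k G.
Proof.
move=> lt_k deg_v /traceable_inducedP[x [p [Pp pN]]] ham.
have sz_p : size p = k.
  case: Pp => _ Up; apply/succn_inj; rewrite -deg_v -[LHS]/(size (x :: p)) -(card_uniqP Up).
  exact: eq_card.
have [|c [cyc_c Uc _ all_c] cp] := ham x p Pp; first by rewrite sz_p.
have nv : v \notin x :: p by rewrite pN inE adj_irr.
have next_v : next c v \in x :: p by rewrite pN inE (next_cycle cyc_c).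
have prev_v : prev c v \in x :: p by rewrite pN inE adj_sym (prev_cycle cyc_c).
have : #|T| <= (size p).+2; last by rewrite sz_p leqNgt lt_k.
case: (cycle_adj_fpath Uc Pp.2 cp) => fp; first exact: spanning_fpath_size fp nv next_v prev_v.
(* A path that runs backwards along [c] runs forwards along [rev c]. *)
apply: (@spanning_fpath_size _ (rev c) v x p); rewrite ?rev_uniq //.
- by move=> y; rewrite mem_rev.
- by rewrite (eq_path (e' := frel (prev c))) // => y z /=; rewrite next_rev.
- by rewrite next_rev.
by rewrite prev_rev.
Qed.

Lemma colorable_clique_free (T : finType) (G : sgraph T) r (col : T -> nat) :
  (forall x, col x < r) -> (forall x y, G x y -> col x != col y) -> clique_free r.+1 G.
Proof.
case: r => [|r] lt_col col_proper A cA clA.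
  by have /card_gt0P[x] : 0 < #|A|; [rewrite cA | have := lt_col x].
pose f x : 'I_r.+1 := Ordinal (lt_col x).
have : #|A| <= #|'I_r.+1|.
  rewrite -(@card_in_imset _ _ f (mem A)) ?max_card // => x y Ax Ay [eq_col].
  by apply: contra_eq eq_col => neq_xy; apply/col_proper/clA.
by rewrite cA card_ord ltnn.
Qed.

(** * Construction of a member of the extremal family *)

Section JExists.
Variables (T : finType) (r k : nat).
Hypotheses (r_ge3 : 2 < r) (lt_k : k + k %/ r.-1 < #|T|.-1).

Let n := #|T|.
Let lt_last : n.-1 < n.
Proof. by have := leq_ltn_trans (leq0n _) lt_k; rewrite -/n; lia. Qed.
Let top : T := enum_val (Ordinal lt_last).

(* The first [k.+1] naturals that are not congruent to [r.-1] modulo [r]. *)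
Definition skip_last i := i + i %/ r.-1.

(** Placing [top] in the last residue class keeps the graph [r]-colourable, hence free of cliques on
    [r.+1] vertices. *)
Definition jcolor x := if x == top then r.-1 else enum_rank x %% r.

Definition jadj : rel T := fun x y =>
  [&& jcolor x != jcolor y, (x == top) ==> (enum_rank y <= skip_last k)
    & (y == top) ==> (enum_rank x <= skip_last k)].

Fact jadj_sym : symmetric jadj.
Proof. by move=> x y; rewrite /jadj eq_sym; congr (_ && _); rewrite andbC. Qed.

Fact jadj_irr : irreflexive jadj.
Proof. by move=> x; rewrite /jadj eqxx. Qed.

Definition jgraph := SGraph jadj_sym jadj_irr.

Lemma jgraph_clique_free : clique_free r.+1 jgraph.
Proof.
apply: (@colorable_clique_free _ _ _ jcolor) => [x|x y /and3P[]//].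
by rewrite /jcolor; case: ifP => _; [lia | rewrite ltn_pmod; lia].
Qed.

Lemma skip_last_mod i : skip_last i %% r = i %% r.-1.
Proof.
have r1_gt0 : 0 < r.-1 by lia.
rewrite /skip_last {1}(divn_eq i r.-1); have := ltn_pmod i r1_gt0.
move: (i %/ _) (i %% _) => q j ltj.
have -> : q * r.-1 + j + q = q * r + j by rewrite -[in RHS](ltn_predK r_ge3) mulnS; lia.
by rewrite modnMDl modn_small; lia.
Qed.

Lemma skip_last_ltn : {mono skip_last : i j / i < j}.
Proof.
have inc i j : i < j -> skip_last i < skip_last j.
  by move=> ltij; rewrite /skip_last -addSn leq_add // leq_div2r // ltnW.
move=> i j; apply/idP/idP; last exact: inc.
by apply: contraTT; rewrite -!leqNgt leq_eqVlt => /orP[/eqP->//|/inc/ltnW].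
Qed.

Lemma skip_last_onto a : a %% r != r.-1 -> exists i, a = skip_last i.
Proof.
move=> neq_a; have r1_gt0 : 0 < r.-1 by lia.
exists (a %/ r * r.-1 + a %% r); rewrite /skip_last divnMDl //.
have lt_a : a %% r < r by rewrite ltn_pmod; lia.
rewrite (divn_small (m := a %% r)) ?addn0; last by lia.
by rewrite {1}(divn_eq a r) -[in X in _ * X](ltn_predK r_ge3) mulnS; lia.
Qed.

Let elt i : T := nth top (enum T) i.

Lemma rank_elt i : i < n -> enum_rank (elt i) = i :> nat.
Proof.
move=> lt_i; have -> : elt i = enum_val (Ordinal lt_i) by rewrite (enum_val_nth top).
by rewrite enum_valK.
Qed.

Lemma top_rank x : (x == top) = (enum_rank x == n.-1 :> nat).
Proof.
rewrite -(inj_eq enum_rank_inj) -(inj_eq val_inj) /= /top enum_valK //.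
Qed.

Lemma jgraph_iso : isomorphic (turan r n.-1) (induced jgraph [set~ top]).
Proof.
have lt_n (i : 'I_n.-1) : i < n by apply: ltn_trans lt_last.
have elt_neq_top (i : 'I_n.-1) : elt i \in [set~ top].
  by rewrite !inE top_rank rank_elt // ltn_eqF.
exists (fun i : 'I_n.-1 => exist (fun x => x \in [set~ top]) (elt i) (elt_neq_top i)); last first.
  move=> i j; rewrite /= /induced_adj /= /jadj /jcolor !top_rank !rank_elt //.
  by rewrite !(ltn_eqF (ltn_ord _)) andbT.
apply: inj_card_bij.
  move=> i j /(congr1 val) /= /(congr1 enum_rank) /(congr1 val) /=.
  by rewrite !rank_elt // => /val_inj.
by rewrite card_sig card_ord -[n.-1](cardsC1 top) subset_leq_card.
Qed.

Let jpath := [seq elt (skip_last i) | i <- iota 0 k.+1].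

Lemma skip_last_lt i : i < k.+1 -> skip_last i < n.-1.
Proof.
move=> le_i; apply: leq_ltn_trans lt_k; rewrite -[k + _]/(skip_last k).
by rewrite leqNgt skip_last_ltn -leqNgt.
Qed.

Lemma jpath_uniq : uniq jpath.
Proof.
rewrite map_inj_in_uniq ?iota_uniq // => i j; rewrite !mem_iota !add0n /= => lei lej.
move/(congr1 enum_rank)/(congr1 val) => /=.
rewrite !rank_elt; try by apply: ltn_trans lt_last; apply: skip_last_lt.
by move=> e; case: (ltngtP i j) => //; rewrite -skip_last_ltn e ltnn.
Qed.

Lemma jpath_nbhd : jpath =i nbhd jgraph top.
Proof.
move=> x; rewrite [RHS]inE -[jgraph _ _]/(jadj _ _) /jadj {1}/jcolor eqxx.
apply/mapP/and3P=> [[i]|[col_x le_x nx]].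
  rewrite mem_iota add0n => /= le_i ->; have lt_i := skip_last_lt le_i.
  have lt_n := ltn_trans lt_i lt_last.
  rewrite /jcolor top_rank rank_elt // (ltn_eqF lt_i) leqNgt skip_last_ltn -leqNgt skip_last_mod.
  by split=> //; rewrite eq_sym ltn_eqF // ltn_pmod; lia.
have neq_x : x != top by apply: contraNneq col_x => ->; rewrite /jcolor eqxx.
have [|i ei] := @skip_last_onto (enum_rank x).
  by move: col_x; rewrite /jcolor (negPf neq_x) eq_sym.
exists i; first by rewrite mem_iota add0n /= ltnS leqNgt -skip_last_ltn -leqNgt -ei.
by rewrite /elt -ei -enum_val_nth enum_rankK.
Qed.

(** By [skip_last_mod] consecutive vertices have colours [i] and [i.+1] modulo [r.-1], which differ
    because [r.-1] is at least 2. *)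
Lemma jpath_path : path jgraph (elt (skip_last 0)) (behead jpath).
Proof.
apply/(pathP top)=> i; rewrite size_map size_iota => lt_i.
have lt_i1 : i.+1 < k.+1 by [].
have -> : nth top (elt (skip_last 0) :: behead jpath) i = elt (skip_last i).
  by rewrite -[_ :: _]/jpath (nth_map 0) ?size_iota 1?ltnW // nth_iota // ltnW.
have -> : nth top (behead jpath) i = elt (skip_last i.+1).
  by rewrite nth_behead (nth_map 0) ?size_iota // nth_iota.
have lt0 := skip_last_lt (ltnW lt_i1); have lt1 := skip_last_lt lt_i1.
rewrite /= /jadj /jcolor !top_rank !rank_elt ?(ltn_trans _ lt_last) //.
rewrite (ltn_eqF lt0) (ltn_eqF lt1) andbT.
rewrite !skip_last_mod modnS; have := ltn_pmod i (_ : 0 < r.-1);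
case: ifP => [dv _|_ _]; last by rewrite ltn_eqF.
apply/eqP=> i0; move: dv; rewrite /dvdn -addn1 -modnDml i0 add0n modn_small //; lia.
Qed.

Lemma jgraph_J : J_family k n r jgraph.
Proof.
split=> //; first exact: jgraph_clique_free.
exists top; split; first exact: jgraph_iso.
  by rewrite /degree -(eq_card jpath_nbhd) (card_uniqP jpath_uniq) size_map size_iota.
apply/traceable_inducedP; exists (elt (skip_last 0)), (behead jpath); split.
  by split; [exact: jpath_path | exact: jpath_uniq].
exact: jpath_nbhd.
Qed.

End JExists.

(** * Clearing denominators, and the final assembly *)

Import GRing.Theory Num.Theory.

Lemma order_bound_nat r k n : (order_bound r k <= n%:R)%R -> large_order r k n.
Proof.
rewrite /order_bound /large_order; case: eqP => [_|/eqP r_neq3].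
  by rewrite -natrM -natrD ler_nat.
case: leqP => [_|r_gt7]; first by rewrite -natrM -natrD ler_nat.
have [q er] : exists q, r = q.+4 by exists (r - 4); lia.
have q_gt0 : (0 < q%:R :> rat)%R by rewrite ltr0n; lia.
have -> : (r%:R - 4 = q%:R :> rat)%R by rewrite er -[q.+4]addn4 natrD addrK.
have -> : r - 4 = q by lia.
rewrite -lerBrDl ler_pdivrMr // mulrBl lerBrDl.
by rewrite -!natrD -!natrM -natrD ler_nat.
Qed.

Theorem theorem4p4 (n r k : nat) (T : finType) (hT : #|T| = n) (hr : 3 <= r)
    (hn : (order_bound r k <= n%:R)%R) :
  [/\ forall G : sgraph T, clique_free r.+1 G -> ~ path_hamiltonian k G ->
        num_edges G <= num_edges (turan r n.-1) + k.+1,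
      exists G : sgraph T, J_family k n r G
    & forall G : sgraph T, J_family k n r G ->
        ~ path_hamiltonian k G
        /\ num_edges G = num_edges (turan r n.-1) + k.+1].
Proof.
have le_n : large_order r k n by apply: order_bound_nat.
have lt_n := large_order_gt hr le_n.
split=> [G freeG nham||G [_ freeG [v [iso_v deg_v tr_v]]]].
- rewrite num_edges_turan; last by lia.
  by subst n; apply: num_edges_not_path_hamiltonian.
- have lt_k : k + k %/ r.-1 < #|T|.-1 by rewrite hT; case: (n) lt_n => // m /ltnW.
  by subst n; exists (jgraph hr lt_k); apply: jgraph_J.
split; last by rewrite (num_edges_del1 iso_v) deg_v.
apply: not_path_hamiltonian deg_v tr_v; rewrite hT; apply: leq_ltn_trans lt_n.
by rewrite !ltnS leq_addr.
Qed.
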